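(* Let $\mathcal{D}$ be a hyperbolic Dynkin diagram. (1) If $\mathcal{D}$ has compact hyperbolic type, then $\mathrm{rank}(\mathcal{D})\leq 5$. (2) If $\mathcal{D}$ is symmetric or symmetrizable and has compact hyperbolic type, then $\mathrm{rank}(\mathcal{D})\leq 4$.
   Context: A generalized Cartan matrix is an integer matrix $A=(a_{ij})_{i,j=1,\dots,\ell}$ with $a_{ii}=2$, $a_{ij}\le 0$ for $i\ne j$, and $a_{ij}=0$ implies $a_{ji}=0$. Its Dynkin diagram $\mathcal{D}$ is the graph on vertices $v_1,\dots,v_\ell$ in which $v_i,v_j$ ($i\neq j$) are joined by an edge iff $a_{ij}\neq 0$, each edge being decorated so as to record the pair $(a_{ij},a_{ji})$; thus $\mathcal{D}$ and $A$ determine each other up to simultaneous reordering of rows and columns. A subdiagram is the diagram of a principal submatrix (obtained by deleting vertices); it is proper if at least one vertex is deleted. $\mathrm{rank}(\mathcal{D})$ is the number of vertices $\ell$. A connected diagram is of finite type if all principal minors of its matrix are positive, and of affine type if all proper principal minors are positive and the determinant is $0$. A connected Dynkin diagram $\mathcal{D}$ is hyperbolic if it is of neither finite nor affine type but every proper connected subdiagram is of finite or affine type. It is of compact hyperbolic type if moreover every proper connected subdiagram is of finite type. $\mathcal{D}$ is symmetric if $A$ is symmetric, and symmetrizable if there exist nonzero rational numbers $d_1,\dots,d_\ell$ such that $\mathrm{diag}(d_1,\dots,d_\ell)A$ is symmetric. *)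

(* Defs.v *)
From HB Require Import structures.
From mathcomp Require Import all_boot all_order all_algebra.

Set Implicit Arguments.
Unset Strict Implicit.
Unset Printing Implicit Defensive.

Import Order.TTheory GRing.Theory Num.Theory.
Local Open Scope ring_scope.

Definition generalized_cartan (n : nat) (A : 'M[int]_n) : Prop :=
  [/\ forall i, A i i = 2,
      forall i j, i != j -> A i j <= 0
    & forall i j, A i j = 0 -> A j i = 0].

Definition principal_submx (R : Type) (n : nat) (A : 'M[R]_n) (S : {set 'I_n}) :
  'M[R]_#|S| := mxsub (@enum_val _ (mem S)) (@enum_val _ (mem S)) A.

Definition principal_minor (R : comNzRingType) (n : nat) (A : 'M[R]_n)
  (S : {set 'I_n}) : R := \det (principal_submx A S).

Lemma generalized_cartan_principal_submx (n : nat) (A : 'M[int]_n)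
  (S : {set 'I_n}) :
  generalized_cartan A -> generalized_cartan (principal_submx A S).
Proof.
case=> A2 Ale0 Asym; split=> [i|i j neq_ij|i j]; rewrite !mxE.
- exact: A2.
- by apply: Ale0; rewrite (inj_eq enum_val_inj).
- exact: Asym.
Qed.

(* The diagram on the vertices 'I_n is carried by its matrix: the edges are
   read off by dynkin_edge, and the decoration of an edge {i, j} is the pair
   (A i j, A j i). Renumbering the vertices gives another record; all the
   notions below are invariant under it. *)
Record dynkin_diagram := DynkinDiagram {
  diagram_rank : nat;
  cartan_mx : 'M[int]_diagram_rank;
  cartan_mxP : generalized_cartan cartan_mx
}.

Definition dynkin_edge (D : dynkin_diagram) : rel 'I_(diagram_rank D) :=
  fun i j => (i != j) && (cartan_mx D i j != 0).

(* The empty diagram is not connected. *)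
Definition connected_diagram (D : dynkin_diagram) : Prop :=
  (0 < diagram_rank D)%N /\ forall i j, connect (@dynkin_edge D) i j.

Definition subdiagram (D : dynkin_diagram) (S : {set 'I_(diagram_rank D)}) :
  dynkin_diagram :=
  DynkinDiagram (generalized_cartan_principal_submx S (cartan_mxP D)).

(* The minor on the empty set of vertices is 1, so it imposes no condition
   here or in affine_type. *)
Definition finite_type (D : dynkin_diagram) : Prop :=
  connected_diagram D /\
  forall S : {set 'I_(diagram_rank D)}, 0 < principal_minor (cartan_mx D) S.

Definition affine_type (D : dynkin_diagram) : Prop :=
  [/\ connected_diagram D,
      forall S : {set 'I_(diagram_rank D)},
        S \proper [set: 'I_(diagram_rank D)] ->
        0 < principal_minor (cartan_mx D) S
    & \det (cartan_mx D) = 0].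

Definition hyperbolic (D : dynkin_diagram) : Prop :=
  [/\ connected_diagram D,
      ~ finite_type D,
      ~ affine_type D
    & forall S : {set 'I_(diagram_rank D)},
        S \proper [set: 'I_(diagram_rank D)] ->
        connected_diagram (subdiagram S) ->
        finite_type (subdiagram S) \/ affine_type (subdiagram S)].

Definition compact_hyperbolic (D : dynkin_diagram) : Prop :=
  hyperbolic D /\
  forall S : {set 'I_(diagram_rank D)},
    S \proper [set: 'I_(diagram_rank D)] ->
    connected_diagram (subdiagram S) -> finite_type (subdiagram S).

Definition symmetric_diagram (D : dynkin_diagram) : Prop :=
  (cartan_mx D)^T = cartan_mx D.

Definition symmetrizable_diagram (D : dynkin_diagram) : Prop :=
  exists d : 'rV[rat]_(diagram_rank D),
    (forall i, d 0 i != 0) /\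
    let B := diag_mx d *m map_mx intr (cartan_mx D) in B^T = B.

(* Main.v *)
Require Import Defs.
From mathcomp Require Import all_boot all_order all_algebra.
From mathcomp Require Import fingroup perm zify ring.

(** The proof replaces the classification of finite type diagrams by an
    argument on vectors.  A subsolution of A is a nonzero vector u >= 0 with
    (A u)_i <= 0 on its support.  A matrix with positive principal minors has
    no subsolution, so in a compact hyperbolic diagram every subsolution has
    full support: otherwise its restriction to a connected component of the
    support would be a subsolution on a proper connected subdiagram, which is
    of finite type ([compact_subsolution_full]).  Conversely, if a principal
    submatrix has determinant <= 0 while its proper principal minors are
    positive, the absolute values of a column of its adjugate form a
    subsolution.  Hence all proper principal minors of A are positive, and
    det A < 0 since A is neither of finite nor of affine type
    ([compact_minors]).

    The heart of the proof is [card_short_le_2].  Suppose that A is symmetrized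
    by lengths d_i in {1, 2}, and let q be the quadratic form of diag(d) A.
    A nonzero integer vector u >= 0 with q(u) <= 0 and minimal coordinate sum
    satisfies q(u - e_x) > 0 for all x in its support.  As
    q(u - e_x) = q(u) + 2 d_x (1 - (A u)_x), this makes u a subsolution, hence
    of full support, and, q being even-valued, it gives (A u)_x <= q(u) / 2 at
    every short vertex x (those with d_x = 1).  If there are s short vertices,
    q(u) = sum_x d_x u_x (A u)_x is therefore at most s q(u) / 2, and q(u) < 0
    because det A != 0; so s <= 2.  Applied to the transpose, where the lengths
    are exchanged, this bounds the number of long vertices by 2 as well, and
    the rank by 4.

    This covers every symmetrizable compact hyperbolic diagram of rank at
    least 5.  There the edges are simple or double, so lengths are powers of 2
    up to a common factor, and conjugating A by a diagonal matrix of powers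
    of 2 reduces the exponents modulo 2 ([rank_le4_of_height]); part (2)
    follows.  For part (1), assume rank at least 6.  If some vertex has degree
    at most 1, every nonempty set of vertices contains a vertex with at most
    one neighbour in the set, so the diagram is a forest and lengths exist
    ([forest_height]).  If all degrees are at least 2, the diagram has no
    double edge, as a double edge would extend to a proper subdiagram that is
    either a short cycle or a path dominating an affine diagram of rank 5
    ([no_double_edge_of_min_degree]); so its matrix is symmetric.  In both
    cases the bound 4 applies, a contradiction. *)

Set Implicit Arguments.
Unset Strict Implicit.
Unset Printing Implicit Defensive.

Import Order.TTheory GRing.Theory Num.Theory.
Local Open Scope ring_scope.

(** * Principal minors and subsolutions *)

Lemma det_mxsub_inj (k m : nat) (g : 'I_k -> 'I_m) (M : 'M[int]_m) :
  injective g -> k = m -> \det (mxsub g g M) = \det M.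
Proof.
move=> g_inj km; case: m / km in g g_inj M *.
have -> : mxsub g g M = row_perm (perm g_inj) (col_perm (perm g_inj) M).
  by apply/matrixP => i j; rewrite !mxE !permE.
rewrite row_permE col_permE !det_mulmx !det_perm odd_permV.
by rewrite mulrC -mulrA -signr_addb addbb mulr1.
Qed.

Lemma cofactor_diag (n : nat) (M : 'M[int]_n.+1) a :
  cofactor M a a = \det (mxsub (lift a) (lift a) M).
Proof.
rewrite /cofactor addnn -signr_odd odd_double mul1r.
by congr (\det _); apply/matrixP => i j; rewrite !mxE.
Qed.

Lemma cV_neq0 (n : nat) (u : 'cV[int]_n) : u != 0 -> exists i, u i 0 != 0.
Proof.
move=> uN0; apply/existsP; apply: contraNT uN0.
rewrite negb_exists => /forallP u0; apply/eqP/matrixP => i j.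
by rewrite (ord1 j) mxE; apply/eqP/negPn/u0.
Qed.

(** Principal minors are indexed by injective maps rather than by sets of
    vertices: composing maps then turns a principal submatrix of a principal
    submatrix into a principal submatrix, without transporting enumerations. *)
Definition minors_pos (n : nat) (A : 'M[int]_n) : Prop :=
  forall k (f : 'I_k -> 'I_n), injective f -> 0 < \det (mxsub f f A).

Definition proper_minors_pos (n : nat) (A : 'M[int]_n) : Prop :=
  forall k (f : 'I_k -> 'I_n), injective f -> (k < n)%N ->
    0 < \det (mxsub f f A).

(** The minors through x grow by t times the complementary minor of x, and the
    others do not change. *)
Lemma minors_pos_add_delta (n : nat) (A : 'M[int]_n) (x : 'I_n) (t : int) :
  minors_pos A -> 0 <= t -> minors_pos (A + t *: delta_mx x x).
Proof.
move=> A_pos t_ge0 k f f_inj; case: (pickP (fun a => f a == x)) => [a|no_x].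
  case: k f f_inj a => [f _ []//|k f f_inj a /eqP fa].
  set M := mxsub f f A; set N := mxsub f f _.
  have Nrow b : N a b = M a b + t *+ (b == a).
    by rewrite !mxE fa eqxx -fa (inj_eq f_inj) mulr_natr.
  have Ncof b : cofactor N a b = cofactor M a b.
    congr (_ * \det _); apply/matrixP => i j; rewrite !mxE -fa (inj_eq f_inj).
    by rewrite eq_sym (negPf (neq_lift _ _)) mulr0 addr0.
  have -> : \det N = \det M + t * \det (mxsub (f \o lift a) (f \o lift a) A).
    rewrite (expand_det_row N a) (expand_det_row M a).
    under eq_bigr => b _ do rewrite Nrow Ncof mulrDl.
    rewrite big_split /= [X in _ + X](bigD1 a) //=.
    rewrite [X in _ + (_ + X)]big1 ?addr0.
      rewrite eqxx mulr1n; congr (_ + t * _).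
      rewrite cofactor_diag; congr (\det _).
      by apply/matrixP => i j; rewrite !mxE.
    by move=> b /negPf->; rewrite mulr0n mul0r.
  rewrite ltr_pwDl ?mulr_ge0 ?A_pos // ltW // A_pos //.
  by move=> i j /= /f_inj /lift_inj.
have -> : mxsub f f (A + t *: delta_mx x x) = mxsub f f A.
  by apply/matrixP => i j; rewrite !mxE no_x mulr0 addr0.
exact: A_pos.
Qed.

Lemma minors_pos_add_diag (n : nat) (A : 'M[int]_n) (m : 'rV[int]_n) :
  minors_pos A -> (forall i, 0 <= m 0 i) -> minors_pos (A + diag_mx m).
Proof.
move=> A_pos m_ge0; rewrite diag_mx_sum_delta.
elim: (index_enum _) A A_pos => [|x s IHs] A A_pos.
  by rewrite big_nil addr0.
by rewrite big_cons addrA; apply/IHs/minors_pos_add_delta.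
Qed.

Lemma minors_pos_mul_diag (n : nat) (A : 'M[int]_n) (u : 'rV[int]_n) :
  minors_pos A -> (forall i, 0 < u 0 i) -> minors_pos (A *m diag_mx u).
Proof.
move=> A_pos u_gt0 k f f_inj.
have -> : mxsub f f (A *m diag_mx u) =
          mxsub f f A *m diag_mx (\row_i u 0 (f i)).
  by apply/matrixP => i j; rewrite !mul_mx_diag !mxE.
rewrite det_mulmx det_diag mulr_gt0 ?A_pos // prodr_gt0 // => i _.
by rewrite mxE.
Qed.

Lemma mulmx_eq0_det (n : nat) (A : 'M[int]_n) (u : 'cV[int]_n) :
  A *m u = 0 -> \det A != 0 -> u = 0.
Proof.
move=> Au0 detN0; have: \adj A *m (A *m u) = 0 by rewrite Au0 mulmx0.
rewrite mulmxA mul_adj_mx mul_scalar_mx => /matrixP detu.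
apply/matrixP => i j; have /eqP := detu i j.
by rewrite !mxE mulf_eq0 (negPf detN0) => /eqP.
Qed.

Definition subsolution (n : nat) (A : 'M[int]_n) (u : 'cV[int]_n) : Prop :=
  [/\ forall i, 0 <= u i 0, u != 0 &
      forall i, u i 0 != 0 -> (A *m u) i 0 <= 0].

(** On the support of u, where u > 0, the matrix A diag(u) + diag(- A u) still
    has positive principal minors, yet it annihilates the vector 1. *)
Lemma subsolution_minors (n : nat) (A : 'M[int]_n) (u : 'cV[int]_n) :
  subsolution A u ->
  ~ (forall k (f : 'I_k -> 'I_n), injective f ->
       (forall a, u (f a) 0 != 0) -> 0 < \det (mxsub f f A)).
Proof.
move=> [u_ge0 uN0 Au_le0] A_pos.
pose S := [set i | u i 0 != 0]; pose f : 'I_#|S| -> 'I_n := @enum_val _ (mem S).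
have f_inj : injective f by apply: enum_val_inj.
have uf a : u (f a) 0 != 0 by have := enum_valP a; rewrite inE.
pose M := mxsub f f A; pose v : 'rV_#|S| := \row_a u (f a) 0.
have M_pos : minors_pos M.
  move=> k g g_inj.
  have -> : mxsub g g M = mxsub (f \o g) (f \o g) A.
    by apply/matrixP => i j; rewrite !mxE.
  by apply: A_pos => [i j /f_inj/g_inj|a] //=.
have Mv a : (M *m v^T) a 0 = (A *m u) (f a) 0.
  rewrite !mxE (bigID (mem S)) /= [X in _ + X]big1 => [|j]; last first.
    by rewrite inE negbK => /eqP->; rewrite mulr0.
  by rewrite addr0 [RHS]big_enum_val; apply: eq_bigr => b _; rewrite !mxE.
pose m : 'rV_#|S| := - (M *m v^T)^T.
have N_pos : minors_pos (M *m diag_mx v + diag_mx m).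
  apply: minors_pos_add_diag; first apply: minors_pos_mul_diag => // a.
    by rewrite mxE lt_def uf u_ge0.
  by move=> a; rewrite mxE [_^T _ _]mxE Mv oppr_ge0 Au_le0.
have det_gt0 : 0 < \det (M *m diag_mx v + diag_mx m).
  by have := N_pos _ id (@inj_id _); rewrite mxsub_id.
have diag1 (w : 'rV[int]_#|S|) : diag_mx w *m const_mx 1 = w^T :> 'cV_#|S|.
  by apply/matrixP => i j; rewrite mul_diag_mx !mxE (ord1 j) mulr1.
have one0 : const_mx 1 = 0 :> 'cV[int]_#|S|.
  apply: mulmx_eq0_det (lt0r_neq0 det_gt0).
  by rewrite mulmxDl -mulmxA !diag1 linearN /= trmxK subrr.
have [i ui] := cV_neq0 uN0.
have iS : i \in S by rewrite inE.
by move/matrixP/(_ (enum_rank_in iS i) 0): one0; rewrite !mxE.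
Qed.

Lemma proper_subsolution_full (n : nat) (A : 'M[int]_n) (u : 'cV[int]_n) :
  proper_minors_pos A -> subsolution A u -> forall i, u i 0 != 0.
Proof.
move=> A_pos Au i; apply/negP => /eqP ui0.
apply: (subsolution_minors Au) => k f f_inj uf; apply: A_pos => //.
have fT : #|f @: setT| = k by rewrite card_imset // cardsT card_ord.
have nT : #|[set: 'I_n]| = n by rewrite cardsT card_ord.
rewrite -fT -[X in (_ < X)%N]nT.
apply/proper_card/properP; split; rewrite ?subsetT //.
exists i; rewrite ?inE //.
by apply/imsetP => -[a _ ia]; move: (uf a); rewrite -ia ui0 eqxx.
Qed.

Definition off_diag_le0 (n : nat) (A : 'M[int]_n) : Prop :=
  forall i j, i != j -> A i j <= 0.

(** Taking absolute values can only decrease the off-diagonal part of a row,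
    since off-diagonal entries are <= 0; the diagonal term is harmless when
    v_i >= 0, and when the row vanishes v can be replaced by - v. *)
Lemma abs_row_le0 (n : nat) (A : 'M[int]_n) (v : 'cV[int]_n) i :
  off_diag_le0 A -> 0 <= A i i -> (0 <= v i 0 \/ (A *m v) i 0 = 0) ->
  (A *m v) i 0 <= 0 -> (A *m map_mx Num.norm v) i 0 <= 0.
Proof.
move=> A_le0 Aii vi; rewrite !mxE (bigD1 i) //= => Av.
rewrite (bigD1 i) //= mxE.
have hs (s : int) : s = 1 \/ s = -1 ->
    \sum_(j < n | j != i) A i j * map_mx Num.norm v j 0
      <= s * \sum_(j < n | j != i) A i j * v j 0.
  move=> hs; rewrite mulr_sumr; apply: ler_sum => j ji; rewrite mxE.
  rewrite mulrCA ler_wnM2l ?A_le0 1?eq_sym //.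
  by case: hs => ->; rewrite ?mul1r ?ler_norm // mulN1r -normrN ler_norm.
have h1 := hs 1 (or_introl erefl); have h2 := hs (-1) (or_intror erefl).
(* s = 1 compares with the row of v, s = -1 with the row of - v. *)
have [vi0|vi0] := lerP 0 (v i 0).
  by rewrite ger0_norm // (le_trans _ Av) // lerD2l -[leRHS]mul1r.
case: vi => [|]; first by rewrite leNgt vi0.
rewrite !mxE (bigD1 i) //= ltr0_norm // mulrN => Av0.
by apply: le_trans (lerD (lexx _) h2) _; rewrite mulN1r -opprD Av0 oppr0.
Qed.

(** M sends the first column of its adjugate to (det M) e_0, and the entry of
    index 0 of that column is the given positive cofactor. *)
Lemma abs_adj_column (k : nat) (M : 'M[int]_k.+1) :
  off_diag_le0 M -> (forall i, 0 <= M i i) -> 0 < cofactor M 0 0 ->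
  \det M <= 0 -> let v := map_mx Num.norm (col 0 (\adj M)) in
  v 0 0 != 0 /\ forall i, (M *m v) i 0 <= 0.
Proof.
move=> M_le0 Mii cof det_le0 v; split.
  by rewrite !mxE normr_eq0 gt_eqF.
have Mv i : (M *m col 0 (\adj M)) i 0 = \det M *+ (i == 0).
  have -> : (M *m col 0 (\adj M)) i 0 = (M *m \adj M) i 0.
    by rewrite !mxE; apply: eq_bigr => j _; rewrite !mxE.
  by rewrite mul_mx_adj mxE.
move=> i; apply: abs_row_le0 => //; rewrite Mv.
  case: eqP => [->|_]; last by right.
  by left; rewrite !mxE ltW.
by case: (i == 0); rewrite ?mulr1n ?mulr0n.
Qed.

(** Induction on the size: a first nonpositive minor would give, through the
    adjugate column extended by zero, a subsolution that misses a vertex. *)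
Lemma proper_minors_pos_of_subsolutions (n : nat) (A : 'M[int]_n) :
  off_diag_le0 A -> (forall i, 0 <= A i i) ->
  (forall u, subsolution A u -> forall i, u i 0 != 0) -> proper_minors_pos A.
Proof.
move=> A_le0 Aii full; elim=> [|k IHk] f f_inj kn; first by rewrite det_mx00.
rewrite ltNge; apply/negP => det_le0; set M := mxsub f f A in det_le0.
have [] := @abs_adj_column k M.
- by move=> i j ij; rewrite mxE A_le0 // (inj_eq f_inj).
- by move=> i; rewrite mxE.
- rewrite cofactor_diag.
  have -> : mxsub (lift 0) (lift 0) M = mxsub (f \o lift 0) (f \o lift 0) A.
    by apply/matrixP => i j; rewrite !mxE.
  by apply: IHk (ltnW kn) => i j /= /f_inj/lift_inj.
- exact: det_le0.
set v := map_mx _ _ => v0 Mv.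
pose u : 'cV[int]_n := \col_i \sum_(a | f a == i) v a 0.
have uf a : u (f a) 0 = v a 0.
  by rewrite mxE (big_pred1 a) // => b; rewrite (inj_eq f_inj).
have Au a : (A *m u) (f a) 0 = (M *m v) a 0.
  rewrite !mxE; under eq_bigr => j _ do rewrite mxE mulr_sumr.
  rewrite (exchange_big_dep predT) //=; apply: eq_bigr => b _.
  by rewrite (big_pred1 (f b)) ?mxE // => j; rewrite eq_sym.
have subs : subsolution A u.
  split=> [i||i].
  - by rewrite mxE; apply: sumr_ge0 => a _; rewrite mxE normr_ge0.
  - by apply: contraNneq v0 => u0; rewrite -uf u0 mxE.
  - have [a /eqP <-|no_i] := pickP (fun a => f a == i); last first.
      by rewrite mxE big1 ?eqxx // => a; rewrite no_i.
    by rewrite Au.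
have := leq_imset_card f setT; rewrite cardsT card_ord => fk.
have [i no_i] : exists i, i \notin f @: setT.
  apply/existsP; rewrite -negb_forall; apply: contraTN kn => /forallP f_onto.
  rewrite -leqNgt -[n]card_ord; apply: leq_trans (max_card _) _.
  rewrite (leq_trans _ fk) // subset_leq_card //.
  by apply/subsetP => i _; apply: f_onto.
move: (full _ subs i); rewrite mxE big1 ?eqxx // => a /eqP fa.
by case/imsetP: no_i; exists a.
Qed.

(** * Compact hyperbolic diagrams have negative determinant *)

Lemma det_mxsub_principal_minor (n k : nat) (A : 'M[int]_n) (f : 'I_k -> 'I_n) :
  injective f -> \det (mxsub f f A) = principal_minor A (f @: setT).
Proof.
move=> f_inj; set S := f @: setT.
have fS a : f a \in S by apply: imset_f.
pose g a := enum_rank_in (fS a) (f a).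
have fg a : enum_val (g a) = f a by apply: enum_rankK_in.
have g_inj : injective g.
  by move=> a b /(congr1 enum_val); rewrite !fg => /f_inj.
rewrite /principal_minor -(det_mxsub_inj _ g_inj).
  by congr (\det _); apply/matrixP => i j; rewrite !mxE !fg.
by rewrite /S card_imset // cardsT card_ord.
Qed.

Lemma dynkin_edge_sym (D : dynkin_diagram) : symmetric (@dynkin_edge D).
Proof.
move=> i j; rewrite /dynkin_edge eq_sym; congr (_ && ~~ _).
by have [_ _ A0] := cartan_mxP D; apply/eqP/eqP => /A0.
Qed.

(** A subsolution vanishing somewhere can be cut down to a connected component
    C of its support, because A has no nonzero entry between C and the rest of
    the support; but C spans a proper connected, hence finite, subdiagram. *)
Lemma compact_subsolution_full (D : dynkin_diagram)
    (u : 'cV[int]_(diagram_rank D)) :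
  compact_hyperbolic D -> subsolution (cartan_mx D) u ->
  forall i, u i 0 != 0.
Proof.
move=> [_ D_fin] [u_ge0 uN0 Au_le0] i; apply/negP => /eqP ui0.
have [i0 ui0N0] := cV_neq0 uN0.
set A := cartan_mx D in Au_le0.
pose e x y := dynkin_edge x y && (u y 0 != 0).
pose C := [set j | connect e i0 j].
have Ci0 : i0 \in C by rewrite inE.
have Cu j : j \in C -> u j 0 != 0.
  rewrite inE => /connectP[p]; elim: p (i0) ui0N0 => [|y p IHp] x ux /=.
    by move=> _ ->.
  by case/andP => /andP[_ uy]; apply: IHp.
have C_closed x y : x \in C -> dynkin_edge x y -> u y 0 != 0 -> y \in C.
  rewrite !inE => i0x xy uy; apply: connect_trans i0x (connect1 _).
  by rewrite /e xy.
have C_fin : finite_type (subdiagram C).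
  apply: D_fin.
    apply/properP; split; rewrite ?subsetT //; exists i; rewrite ?inE //.
    by apply/negP => iC; have := Cu i; rewrite inE ui0 eqxx => /(_ iC).
  pose r := enum_rank_in Ci0.
  have sub_path x p : x \in C -> path e x p ->
      connect (@dynkin_edge (subdiagram C)) (r x) (r (last x p)).
    elim: p x => [|y p IHp] x xC /=; first by rewrite connect0.
    case/andP => /andP[xy uy] yp; have yC := C_closed x y xC xy uy.
    apply: connect_trans (IHp y yC yp); apply: connect1.
    rewrite /dynkin_edge /= mxE !enum_rankK_in //.
    case/andP: xy => neq_xy ->; rewrite andbT; apply: contraNneq neq_xy.
    by move/(congr1 enum_val); rewrite !enum_rankK_in // => ->.
  have sub_i0 j : connect (@dynkin_edge (subdiagram C)) (r i0) j.
    have := enum_valP j; rewrite {1}/C inE => /connectP[p /(sub_path _ _ Ci0)].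
    by move=> + jE; rewrite -jE /r enum_valK_in.
  split; first by rewrite /= card_gt0; apply/set0Pn; exists i0.
  move=> j k; apply: connect_trans (sub_i0 k).
  by rewrite (sym_connect_sym (@dynkin_edge_sym _)).
pose v : 'cV[int]_(diagram_rank D) := \col_j if j \in C then u j 0 else 0.
have v_sub : subsolution A v.
  split=> [j||j].
  - by rewrite mxE; case: ifP.
  - by apply: contraNneq ui0N0 => /matrixP/(_ i0 0); rewrite !mxE Ci0 => ->.
  rewrite mxE; case: ifP => [jC uj|]; last by rewrite eqxx.
  apply: le_trans (Au_le0 j uj); rewrite !mxE; apply: ler_sum => k _.
  rewrite mxE; case: ifPn => // kC; rewrite mulr0.
  have [->|uk] := eqVneq (u k 0) 0; first by rewrite mulr0.
  have [Ajk|Ajk] := eqVneq (A j k) 0; first by rewrite Ajk mul0r.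
  have [jk|jk] := eqVneq j k; first by rewrite -jk jC in kC.
  by rewrite (C_closed j k) // /dynkin_edge jk Ajk in kC.
apply: (subsolution_minors v_sub) => k f f_inj vf.
have fC a : f a \in C by have := vf a; rewrite mxE; case: ifP; rewrite ?eqxx.
pose g a := enum_rank_in (fC a) (f a).
have fg a : enum_val (g a) = f a by apply: enum_rankK_in.
have g_inj : injective g.
  by move=> a b /(congr1 enum_val); rewrite !fg => /f_inj.
have -> : mxsub f f A = mxsub g g (principal_submx A C).
  by apply/matrixP => a b; rewrite !mxE !fg.
by rewrite det_mxsub_principal_minor //; apply: C_fin.2.
Qed.

Lemma compact_minors (D : dynkin_diagram) :
  compact_hyperbolic D ->
  proper_minors_pos (cartan_mx D) /\ \det (cartan_mx D) < 0.
Proof.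
move=> D_comp; have [A2 A_le0 _] := cartan_mxP D.
have A_pos : proper_minors_pos (cartan_mx D).
  apply: proper_minors_pos_of_subsolutions => // [i|u]; first by rewrite A2.
  exact: compact_subsolution_full.
split=> //; have [[D_conn not_fin not_aff _] _] := D_comp.
have minor_pos (S : {set 'I_(diagram_rank D)}) :
    S \proper [set: 'I_(diagram_rank D)] ->
    0 < principal_minor (cartan_mx D) S.
  move=> /proper_card; rewrite cardsT card_ord => ltS.
  exact: A_pos enum_val_inj ltS.
rewrite ltNge le_eqVlt; apply/negP => /orP[/eqP det0|det_gt0].
  by apply: not_aff; split.
apply: not_fin; split=> // S.
have [/minor_pos //|] := boolP (S \proper setT).
rewrite properT negbK => /eqP->; rewrite /principal_minor /principal_submx.
by rewrite det_mxsub_inj //; [apply: enum_val_inj | rewrite cardsT card_ord].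
Qed.

(** * Counting short vertices with the quadratic form *)

Definition qform (n : nat) (B : 'M[int]_n) (u : 'cV[int]_n) : int :=
  (u^T *m (B *m u)) 0 0.

Lemma qformE (n : nat) (B : 'M[int]_n) (u : 'cV[int]_n) :
  qform B u = \sum_i u i 0 * (B *m u) i 0.
Proof. by rewrite /qform mxE; apply: eq_bigr => i _; rewrite mxE. Qed.

Lemma qform_sub_delta (n : nat) (B : 'M[int]_n) (u : 'cV[int]_n) x :
  B^T = B ->
  qform B (u - delta_mx x 0) = qform B u - (B *m u) x 0 *+ 2 + B x x.
Proof.
move=> B_sym; rewrite /qform; set e := delta_mx x 0.
have eL (w : 'cV[int]_n) : (e^T *m w) 0 0 = w x 0.
  by rewrite trmx_delta -rowE mxE.
have uBe : (u^T *m (B *m e)) 0 0 = (B *m u) x 0.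
  have -> : (u^T *m (B *m e)) 0 0 = (u^T *m (B *m e))^T 0 0.
    by rewrite [RHS]mxE.
  by rewrite !trmx_mul trmxK B_sym -mulmxA eL.
have eBe : (e^T *m (B *m e)) 0 0 = B x x by rewrite eL -colE mxE.
have -> : (u - e)^T *m (B *m (u - e)) =
    u^T *m (B *m u) - u^T *m (B *m e) - (e^T *m (B *m u) - e^T *m (B *m e)).
  by rewrite linearB /= mulmxBl !mulmxBr.
have subE (M N : 'M[int]_1) : (M - N) 0 0 = M 0 0 - N 0 0 by rewrite !mxE.
by rewrite !subE uBe eBe eL; ring.
Qed.

Lemma nonneg_vec_ind (n : nat) (P : 'cV[int]_n -> Prop) :
  (forall u : 'cV[int]_n, (forall i, 0 <= u i 0) ->
     (forall x, 0 < u x 0 -> P (u - delta_mx x 0)) -> P u) ->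
  forall u : 'cV[int]_n, (forall i, 0 <= u i 0) -> P u.
Proof.
move=> IH u; have [N] := ubnP (absz (\sum_i u i 0)).
elim: N u => // N IHN u uN u_ge0.
apply: IH => // x ux.
have v_ge0 i : 0 <= (u - delta_mx x 0) i 0.
  by rewrite !mxE andbT; case: eqP => [->|_]; rewrite /= ?subr0 ?subr_ge0.
apply: IHN => //.
have : \sum_i (u - delta_mx x 0) i 0 = \sum_i u i 0 - 1.
  under eq_bigr do rewrite !mxE andbT.
  rewrite sumrB; congr (_ - _); rewrite (bigD1 x) //= eqxx big1 ?addr0 //.
  by move=> i /negPf->.
have : 0 <= \sum_i (u - delta_mx x 0) i 0 by apply: sumr_ge0.
move: uN; set X := \sum_i u i 0; set Y := \sum_i _; move: X Y => X Y.
lia.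
Qed.

Lemma qform_even (n : nat) (B : 'M[int]_n) (u : 'cV[int]_n) :
  B^T = B -> (forall i, exists b, B i i = b *+ 2) -> (forall i, 0 <= u i 0) ->
  exists q, qform B u = q *+ 2.
Proof.
move=> B_sym B_even; move: u; apply: nonneg_vec_ind => u u_ge0 IH.
have [x ux|u_le0] := pickP (fun x => 0 < u x 0).
  have [q] := IH x ux; have [b Bxx] := B_even x.
  by rewrite qform_sub_delta // Bxx => qE; exists (q + (B *m u) x 0 - b); lia.
exists 0; rewrite qformE big1 // => i _.
by have := u_ge0 i; rewrite le_eqVlt u_le0 orbF => /eqP<-; rewrite mul0r.
Qed.

(** The vector w is found by descent: subtract basis vectors for as long as the
    form stays nonpositive. *)
Lemma minimal_qform_le0 (n : nat) (B : 'M[int]_n) (u : 'cV[int]_n) :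
  B^T = B -> (forall i, 0 < B i i) -> (forall i, 0 <= u i 0) -> u != 0 ->
  qform B u <= 0 ->
  exists w : 'cV[int]_n, [/\ forall i, 0 <= w i 0, w != 0, qform B w <= 0 &
    forall x, 0 < w x 0 -> 0 < qform B (w - delta_mx x 0)].
Proof.
move=> B_sym B_gt0; move: u; apply: nonneg_vec_ind => u u_ge0 IH uN0 qu.
have [x /andP[ux qx]|no_x] :=
    pickP (fun x => (0 < u x 0) && (qform B (u - delta_mx x 0) <= 0)).
  apply: (IH x ux) => //; rewrite subr_eq0; apply/eqP => ue.
  move: qx; rewrite qform_sub_delta //.
  have -> : qform B u = B x x.
    by rewrite /qform ue trmx_delta -rowE mxE -colE mxE.
  have := B_gt0 x; move: qu.
  by rewrite /qform ue trmx_delta -rowE mxE -colE mxE; lia.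
exists u; split=> // x ux; have := no_x x; rewrite ux /= => /negbT.
by rewrite -ltNge.
Qed.

Lemma exists_subsolution_of_det_le0 (n : nat) (A : 'M[int]_n) :
  (0 < n)%N -> off_diag_le0 A -> (forall i, 0 <= A i i) ->
  proper_minors_pos A -> \det A <= 0 ->
  exists u : 'cV[int]_n, [/\ forall i, 0 <= u i 0, u != 0 &
    forall i, (A *m u) i 0 <= 0].
Proof.
case: n A => // k A _ A_le0 Aii A_pos detA.
have [|u0 Au] := @abs_adj_column k A A_le0 Aii _ detA.
  by rewrite cofactor_diag; apply: A_pos => //; apply: lift_inj.
eexists; split; last exact: Au.
  by move=> i; rewrite mxE.
by apply: contraNneq u0 => ->; rewrite mxE.
Qed.

(** Minimality of w gives 2 (A w)_x <= q(w) at each short vertex x, whereas the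
    short vertices together account for a sum of d_x w_x (A w)_x at least q(w);
    since q(w) < 0, there are at most two of them. *)
Lemma card_short_le_2 (n : nat) (A : 'M[int]_n) (d : 'I_n -> int) :
  (forall i, A i i = 2) -> off_diag_le0 A ->
  (forall i, d i = 1 \/ d i = 2) -> (forall i j, d i * A i j = d j * A j i) ->
  proper_minors_pos A -> \det A < 0 ->
  (#|[set i | d i == 1%R]| <= 2)%N.
Proof.
move=> A2 A_le0 d12 dA A_pos detA.
have [n0|n_gt0] := posnP n.
  by rewrite (leq_trans (max_card _)) // card_ord n0.
pose B := \matrix_(i, j) (d i * A i j).
have B_sym : B^T = B by apply/matrixP => i j; rewrite !mxE dA.
have Bii i : B i i = d i *+ 2 by rewrite mxE A2 mulr_natr.
have Bu u i : (B *m u) i 0 = d i * (A *m u) i 0.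
  by rewrite !mxE mulr_sumr; apply: eq_bigr => j _; rewrite mxE mulrA.
have d_gt0 i : 0 < d i by case: (d12 i) => ->.
have [|u [u_ge0 uN0 Au]] :=
    exists_subsolution_of_det_le0 n_gt0 A_le0 _ A_pos (ltW detA).
  by move=> i; rewrite A2.
have qu : qform B u <= 0.
  rewrite qformE; apply: sumr_le0 => i _; rewrite Bu.
  by rewrite mulr_ge0_le0 // mulr_ge0_le0 // ltW.
have [|w [w_ge0 wN0 qw w_min]] := minimal_qform_le0 B_sym _ u_ge0 uN0 qu.
  by move=> i; rewrite Bii pmulrn_lgt0.
have stepE x : 0 < w x 0 -> 0 < qform B w + (d x - d x * (A *m w) x 0) *+ 2.
  move=> /w_min; rewrite qform_sub_delta // Bii Bu; lia.
have Aw x : w x 0 != 0 -> (A *m w) x 0 <= 0.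
  move=> wx; have := stepE x; rewrite lt_def wx w_ge0 => /(_ isT).
  by case: (d12 x) => ->; lia.
have w_full : forall x, 0 < w x 0.
  by move=> x; rewrite lt_def w_ge0 (proper_subsolution_full A_pos).
have {}Aw x : (A *m w) x 0 <= 0 by apply: Aw; rewrite gt_eqF.
have [|q qE] := @qform_even n B w B_sym _ w_ge0.
  by move=> i; exists (d i); rewrite Bii.
have q_lt0 : q < 0.
  have : qform B w != 0.
    apply: contraNneq wN0 => q0; apply/eqP.
    apply: mulmx_eq0_det (ltr0_neq0 detA).
    apply/matrixP => i j; rewrite (ord1 j) [RHS]mxE; apply/eqP.
    move/eqP: q0.
    rewrite qformE -oppr_eq0 -sumrN psumr_eq0 => [/allP/(_ i)|k _].
      rewrite mem_index_enum => /(_ isT); rewrite Bu oppr_eq0 !mulf_eq0.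
      by rewrite (gt_eqF (w_full i)) (gt_eqF (d_gt0 i)).
    rewrite Bu oppr_ge0 mulr_ge0_le0 // mulr_ge0_le0 // ltW //.
  by rewrite qE; move: qw; rewrite qE; lia.
have short x : d x = 1 -> q >= (A *m w) x 0.
  by move=> dx; have := stepE x (w_full x); rewrite qE dx; lia.
pose S := [set i | d i == 1].
have sumS : \sum_(i in S) q >= q *+ 2.
  rewrite -qE qformE (bigID (mem S)) /=.
  rewrite -[leRHS]addr0 lerD //.
    apply: ler_sum => i; rewrite inE => /eqP di; rewrite Bu di mul1r.
    have := short i di; have := Aw i; have := w_full i; nia.
  by apply: sumr_le0 => i _; rewrite Bu mulr_ge0_le0 // mulr_ge0_le0 // ltW.
by move: sumS; rewrite sumr_const ler_nMn2l.
Qed.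

(** * Reducing lengths modulo squares *)

(** A height is the exponent of 2 in the length of a vertex: 2 ^ h symmetrizes
    A on S when all edges are simple or double. *)
Definition height_on (n : nat) (A : 'M[int]_n) (S : {set 'I_n})
    (h : 'I_n -> nat) : Prop :=
  forall i j, i \in S -> j \in S -> i != j -> A i j != 0 ->
  [\/ [/\ A i j = -1, A j i = -1 & h i = h j],
      [/\ A i j = -2, A j i = -1 & h j = (h i).+1] |
      [/\ A i j = -1, A j i = -2 & h i = (h j).+1]].

Lemma proper_minors_pos_trmx (n : nat) (A : 'M[int]_n) :
  proper_minors_pos A -> proper_minors_pos A^T.
Proof.
move=> A_pos k f f_inj kn; have -> : mxsub f f A^T = (mxsub f f A)^T.
  by apply/matrixP => i j; rewrite !mxE.
by rewrite det_tr A_pos.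
Qed.

Lemma det_mxsub_conj (n k : nat) (A B : 'M[int]_n) (c : 'I_n -> int)
    (f : 'I_k -> 'I_n) :
  (forall i, c i != 0) -> (forall i j, c i * A i j = B i j * c j) ->
  \det (mxsub f f A) = \det (mxsub f f B).
Proof.
move=> cN0 cAB; pose C := diag_mx (\row_a c (f a)).
have /(congr1 determinant) : C *m mxsub f f A = mxsub f f B *m C.
  by apply/matrixP => a b; rewrite mul_diag_mx mul_mx_diag !mxE cAB.
rewrite !det_mulmx mulrC; apply: mulIf; rewrite det_diag.
by apply/prodf_neq0 => a _; rewrite mxE.
Qed.

(** Conjugation by diag(2 ^ (h / 2)) keeps all principal minors and yields a
    Cartan matrix B symmetrized by the lengths 2 ^ (h mod 2).  Both B and its
    transpose have at most two short vertices. *)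
Lemma rank_le4_of_height (n : nat) (A : 'M[int]_n) (h : 'I_n -> nat) :
  generalized_cartan A -> proper_minors_pos A -> \det A < 0 ->
  height_on A setT h -> (n <= 4)%N.
Proof.
move=> [A2 A_le0 A0] A_pos detA hA.
pose B : 'M[int]_n := \matrix_(i, j)
  if i == j then 2 else if A i j == 0 then 0 else
  if odd (h i) == odd (h j) then -1 else if odd (h i) then -1 else -2.
pose c i : int := 2 ^+ (h i)./2; pose d i : int := if odd (h i) then 2 else 1.
have cN0 i : c i != 0 by rewrite expf_neq0.
have cAB i j : c i * A i j = B i j * c j.
  rewrite mxE; have [<-|ij] := eqVneq i j; first by rewrite A2 mulrC.
  have [->|Aij] := eqVneq (A i j) 0; first by rewrite mulr0 mul0r.
  have [] := hA i j (in_setT _) (in_setT _) ij Aij => -[-> _ hij];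
    rewrite /c hij.
  - by rewrite eqxx mulrC.
  - rewrite /= uphalf_half; case: (odd (h i)) => /=; last by rewrite mulrC.
    by rewrite add1n exprS; ring.
  - rewrite /= uphalf_half; case: (odd (h j)) => /=; last by rewrite mulrC.
    by rewrite add1n exprS; ring.
have A_eq0 i j : (A j i == 0) = (A i j == 0) by apply/eqP/eqP => /A0.
have dB i j : d i * B i j = d j * B j i.
  rewrite !mxE /d eq_sym [odd (h j) == _]eq_sym.
  have [<-|ij] := eqVneq i j; first by [].
  rewrite (A_eq0 i j).
  by case: (A i j == 0); case: (odd (h i)); case: (odd (h j)).
have B2 i : B i i = 2 by rewrite mxE eqxx.
have B_le0 : off_diag_le0 B.
  by move=> i j /negPf ij; rewrite mxE ij; do 3! case: ifP => //.
have B_pos : proper_minors_pos B.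
  by move=> k f f_inj kn; rewrite -(det_mxsub_conj _ cN0 cAB) A_pos.
have detB : \det B < 0.
  by have := @det_mxsub_conj _ _ _ _ _ id cN0 cAB; rewrite !mxsub_id => <-.
have short : (#|[set i | d i == 1%R]| <= 2)%N.
  apply: card_short_le_2 dB B_pos detB => // i.
  by rewrite /d; case: ifP; [right | left].
have long : (#|[set i | (3 - d i)%R == 1%R]| <= 2)%N.
  apply: (@card_short_le_2 _ B^T) => [i|i j||i j||].
  - by rewrite mxE.
  - by rewrite eq_sym mxE; apply: B_le0.
  - by move=> i; rewrite /d; case: ifP; [left | right].
  - rewrite !mxE /d eq_sym [odd (h j) == _]eq_sym.
    have [<-|ij] := eqVneq i j; first by [].
    rewrite (A_eq0 i j).
    by case: (A i j == 0); case: (odd (h i)); case: (odd (h j)).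
  - exact: proper_minors_pos_trmx.
  - by rewrite det_tr.
have : (#|[set i | d i == 1%R] :|: [set i | (3 - d i)%R == 1%R]| = n)%N.
  rewrite -[RHS]card_ord -cardsT; apply: eq_card => i.
  by rewrite !inE /d; case: ifP.
by move=> <-; rewrite (leq_trans (leq_card_setU _ _)) // (leq_add short long).
Qed.

(** * Edges, leaves and forests *)

(** The device for excluding small subdiagrams: s lists vertices with positive
    weights.  The weights only have to be checked against bounds on the
    entries, so each vector below excludes a whole family of diagrams that
    dominate an affine one. *)
Lemma seq_subsolution_large (n : nat) (A : 'M[int]_n) (s : seq ('I_n * int)) :
  proper_minors_pos A -> s != [::] -> all (fun p => 0 < p.2) s ->
  (forall x, x \in map fst s -> \sum_(p <- s) A x p.1 * p.2 <= 0) ->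
  (n <= size s)%N.
Proof.
move=> A_pos sN0 /allP s_gt0 rows; rewrite leqNgt; apply/negP => sn.
pose u : 'cV[int]_n := \col_i \sum_(p <- s | p.1 == i) p.2.
have Au x : (A *m u) x 0 = \sum_(p <- s) A x p.1 * p.2.
  rewrite mxE; under eq_bigr => i _ do rewrite mxE mulr_sumr.
  rewrite (exchange_big_dep predT) //=; apply: eq_bigr => p _.
  by rewrite (big_pred1 p.1) // => j; rewrite eq_sym.
have u_out i : i \notin map fst s -> u i 0 = 0.
  move=> i_s; rewrite mxE big_seq_cond big1 // => p /andP[ps /eqP pi].
  by case/negP: i_s; rewrite -pi map_f.
have u_ge0 i : 0 <= u i 0.
  by rewrite mxE big_seq_cond sumr_ge0 // => p /andP[/s_gt0/ltW].
have u_sub : subsolution A u.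
  split=> [//||i ui]; last first.
    by rewrite Au rows //; apply: contraNT ui => /u_out->.
  case: s sN0 s_gt0 {rows sn u_out u_ge0 Au} @u => // p s _ s_gt0.
  set u := \col_i _; apply/eqP => /matrixP/(_ p.1 0); apply/eqP.
  rewrite !mxE big_cons eqxx gt_eqF // ltr_wpDr ?s_gt0 ?mem_head //.
  rewrite big_seq_cond sumr_ge0 // => q /andP[qs _].
  by rewrite ltW // s_gt0 // inE qs orbT.
have [i i_s] : exists i, i \notin map fst s.
  apply/existsP; rewrite -negb_forall; apply: contraTN sn => /forallP s_full.
  rewrite -leqNgt -(size_map fst) (leq_trans _ (card_size _)) //.
  rewrite -[leqLHS]card_ord subset_leq_card //.
  by apply/subsetP => i _; apply: s_full.
by have := proper_subsolution_full A_pos u_sub i; rewrite u_out ?eqxx.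
Qed.

Lemma edge_le_m1 (D : dynkin_diagram) i j :
  dynkin_edge i j -> cartan_mx D i j <= -1.
Proof.
have [_ A_le0 _] := cartan_mxP D.
by case/andP => /A_le0; move: (cartan_mx D i j) => a; lia.
Qed.

Lemma connected_third_vertex (D : dynkin_diagram) (i j : 'I_(diagram_rank D)) :
  connected_diagram D -> (2 < diagram_rank D)%N ->
  exists k, [&& k != i, k != j & dynkin_edge i k || dynkin_edge j k].
Proof.
move=> [_ conn] n_gt2; apply/existsP; apply: contraT => /existsPn no_k.
have cl : closed (@dynkin_edge D) (mem [set i; j]).
  apply: intro_closed; first exact/sym_connect_sym/dynkin_edge_sym.
  move=> x y xy; rewrite !inE => x_ij; apply: contraNT (no_k y).
  rewrite negb_or => /andP[-> ->] /=.
  by case/orP: x_ij => /eqP <-; rewrite xy ?orbT.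
have /subsetPn[z _] : ~~ ([set: 'I_(diagram_rank D)] \subset [set i; j]).
  apply: contraTN n_gt2 => /subset_leq_card; rewrite cardsT card_ord -leqNgt.
  by move/leq_trans; apply; rewrite cards2; case: (_ == _).
by rewrite -(closed_connect cl (conn i z)) !inE eqxx.
Qed.

(** The decorations of a simple edge and of the two orientations of a double
    edge. *)
Definition edge_spec (a b : int) :=
  [\/ a = -1 /\ b = -1, a = -2 /\ b = -1 | a = -1 /\ b = -2].

(** Two entries <= -2 on an edge dominate the affine diagram A_1^(1), and an
    entry <= -3 together with any third adjacent vertex dominates an affine
    diagram of rank 3 (G_2^(1) or its dual). *)
Lemma dynkin_edgeP (D : dynkin_diagram) i j :
  connected_diagram D -> proper_minors_pos (cartan_mx D) ->
  (3 < diagram_rank D)%N -> dynkin_edge i j ->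
  edge_spec (cartan_mx D i j) (cartan_mx D j i).
Proof.
move=> conn A_pos n_gt3 e_ij; have [A2 A_le0 _] := cartan_mxP D.
have e_ji : dynkin_edge j i by rewrite dynkin_edge_sym.
have not22 : ~ (cartan_mx D i j <= -2 /\ cartan_mx D j i <= -2).
  move=> [aij aji].
  have := @seq_subsolution_large _ _ [:: (i, 1); (j, 1)]
    A_pos isT isT.
  rewrite leqNgt (ltn_trans _ n_gt3) // => /(_ _)/negP[]// x.
  rewrite !inE => /orP[]/eqP->; rewrite !big_cons big_nil /= !A2; lia.
have not3 k l : dynkin_edge k l -> ~ (cartan_mx D k l <= -3).
  move=> e_kl akl; have /andP[neq_kl _] := e_kl.
  have alk : cartan_mx D l k <= -1.
    by apply: edge_le_m1; rewrite dynkin_edge_sym.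
  have [m /and3P[mk ml e_m]] := connected_third_vertex k l conn (ltnW n_gt3).
  have := A_le0 _ _ mk; have := A_le0 _ _ ml.
  have := A_le0 k m; have := A_le0 l m; rewrite ![_ == m]eq_sym.
  move=> /(_ ml) alm /(_ mk) akm aml amk.
  case/orP: e_m => e_m; have e_m' := e_m; rewrite dynkin_edge_sym in e_m';
    have h1 := edge_le_m1 e_m; have h2 := edge_le_m1 e_m'.
  - have := @seq_subsolution_large _ _ [:: (k, 2); (l, 1); (m, 1)]
      A_pos isT isT.
    rewrite leqNgt n_gt3 => /(_ _)/negP[]// x.
    rewrite !inE => /or3P[]/eqP->; rewrite !big_cons big_nil /= !A2; lia.
  - have := @seq_subsolution_large _ _ [:: (k, 3); (l, 2); (m, 1)]
      A_pos isT isT.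
    rewrite leqNgt n_gt3 => /(_ _)/negP[]// x.
    rewrite !inE => /or3P[]/eqP->; rewrite !big_cons big_nil /= !A2; lia.
have := edge_le_m1 e_ij; have := edge_le_m1 e_ji.
have := not3 _ _ e_ij; have := not3 _ _ e_ji; move: not22; rewrite /edge_spec.
move: (cartan_mx D i j) (cartan_mx D j i) => a b.
move=> not22 nb na b1 a1.
have [a2|a2] : a = -1 \/ a = -2 by lia.
  have [|] : b = -1 \/ b = -2 by lia.
    by move=> ->; constructor 1.
  by move=> ->; constructor 3.
by constructor 2; lia.
Qed.

(** If every vertex of S had two neighbours in S, the indicator vector of S
    would be a subsolution: its rows are at most 2 minus the degree. *)
Lemma proper_has_leaf (D : dynkin_diagram) (S : {set 'I_(diagram_rank D)}) :
  proper_minors_pos (cartan_mx D) -> S \proper setT -> S != set0 ->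
  exists2 v, v \in S & (#|[set j in S | dynkin_edge v j]| <= 1)%N.
Proof.
move=> A_pos S_prop S_N0; apply/exists_inP.
apply: contraT => /exists_inPn no_leaf.
have [A2 A_le0 _] := cartan_mxP D.
pose u : 'cV[int]_(diagram_rank D) := \col_i (i \in S)%:R.
have uS i : (u i 0 != 0) = (i \in S) by rewrite mxE pnatr_eq0 eqb0 negbK.
have /properP[_ [i _ iS]] := S_prop.
suff u_sub : subsolution (cartan_mx D) u.
  by have := proper_subsolution_full A_pos u_sub i; rewrite uS (negPf iS).
split=> [k||k].
- by rewrite mxE ler0n.
- have [k kS] := set0Pn _ S_N0; rewrite -uS in kS.
  by apply: contraNneq kS => ->; rewrite mxE.
rewrite uS => kS; have := no_leaf k kS; rewrite -ltnNge => deg_gt1.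
rewrite mxE (bigD1 k) //= A2 mxE kS mulr1.
set N := [set j in S | _] in deg_gt1.
have : \sum_(j | j != k) cartan_mx D k j * u j 0 <= \sum_(j in N) (-1).
  rewrite (bigID (mem N)) /= -[leRHS]addr0 lerD //.
    rewrite [leLHS](eq_bigl (fun j => j \in N)) => [|j]; last first.
      rewrite /= /N !inE /dynkin_edge eq_sym.
      by case: (k == j); rewrite ?andbF.
    apply: ler_sum => j; rewrite inE => /andP[jS /edge_le_m1].
    by rewrite mxE jS mulr1.
  apply: sumr_le0 => j /andP[jk _]; rewrite mulr_le0_ge0 ?A_le0 1?eq_sym //.
  by rewrite mxE ler0n.
rewrite sumr_const mulNrn natz.
by move: deg_gt1 (\sum_(_ | _) _) => + X; lia.
Qed.

(** Leaves are added one at a time, the unique edge to the leaf v dictating its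
    height. *)
Lemma forest_height (D : dynkin_diagram) (S : {set 'I_(diagram_rank D)}) :
  (forall i j, dynkin_edge i j ->
     edge_spec (cartan_mx D i j) (cartan_mx D j i)) ->
  (forall S : {set 'I_(diagram_rank D)}, S != set0 ->
     exists2 v, v \in S & (#|[set j in S | dynkin_edge v j]| <= 1)%N) ->
  exists h, height_on (cartan_mx D) S h.
Proof.
move=> edgeP leafP; have [m] := ubnP #|S|; elim: m S => // m IHm S Sm.
have [->|S_N0] := eqVneq S set0.
  by exists (fun=> 0%N) => i j; rewrite inE.
have [v vS deg_v] := leafP S S_N0.
have [|h hS] := IHm (S :\ v).
  by rewrite (cardsD1 v S) vS in Sm.
(* The old heights are raised by one, since h v may have to be h w - 1. *)
pose hv w := (if cartan_mx D w v == -2 then (h w).+2 else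
              if cartan_mx D v w == -2 then h w else (h w).+1).
pose x := odflt v [pick j in S | dynkin_edge v j].
have x_nbr w : w \in S -> dynkin_edge v w -> w = x.
  move=> wS vw; rewrite /x; case: pickP => [y /andP[yS vy]|/(_ w)]; last first.
    by rewrite /= wS vw.
  have/card_le1_eqP := deg_v; apply; rewrite inE /=; exact/andP.
exists (fun i => if i == v then hv x else (h i).+1) => i j iS jS ij Aij.
have e_ij : dynkin_edge i j by rewrite /dynkin_edge ij.
have [iv|iv] := eqVneq i v; have [jv|jv] := eqVneq j v.
- by rewrite iv jv eqxx in ij.
- rewrite -(x_nbr j jS) -?iv // /hv -iv.
  have [] := edgeP _ _ e_ij => -[-> ->] /=.
  + by constructor 1.
  + by constructor 2.
  + by constructor 3.
- rewrite -(x_nbr i iS) -?jv // /hv -?jv 1?dynkin_edge_sym //.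
  have [] := edgeP _ _ e_ij => -[-> ->] /=.
  + by constructor 1.
  + by constructor 2.
  + by constructor 3.
have [] := hS i j _ _ ij Aij; rewrite ?inE ?iv ?jv // => -[-> -> hij].
+ by constructor 1; rewrite hij.
+ by constructor 2; rewrite hij.
+ by constructor 3; rewrite hij.
Qed.

(** * Cyclic and symmetrizable diagrams *)

(** Walk from the double edge i - j to further vertices z - i = j - k - l, which
    minimal degree 2 allows.  If two of these coincide, the walk closes up into
    a triangle or a 4-cycle; otherwise the weights 2, 4, 3, 2, 1, those of an
    affine diagram of rank 5 extending F_4, give a subsolution.  Either way its
    support is proper in rank at least 6. *)
Lemma no_double_edge_of_min_degree (D : dynkin_diagram) i j :
  proper_minors_pos (cartan_mx D) -> (5 < diagram_rank D)%N ->
  (forall x y : 'I_(diagram_rank D), exists2 z, z != y & dynkin_edge x z) ->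
  dynkin_edge i j -> cartan_mx D i j != -2.
Proof.
move=> A_pos n_gt5 deg2 e_ij; apply/eqP => Aij.
have [A2 A_le0 _] := cartan_mxP D.
have eC x y : dynkin_edge x y = @dynkin_edge D y x by apply: dynkin_edge_sym.
have noC3 x y z : dynkin_edge x y -> dynkin_edge y z -> ~~ @dynkin_edge D z x.
  move=> xy yz; apply/negP => zx.
  have := @seq_subsolution_large _ _ [:: (x, 1); (y, 1); (z, 1)]
    A_pos isT isT.
  rewrite leqNgt (leq_trans _ n_gt5) // => /(_ _)/negP[]// w.
  have := (edge_le_m1 xy, edge_le_m1 yz, edge_le_m1 zx).
  rewrite eC in xy; rewrite eC in yz; rewrite eC in zx.
  move=> [[? ?] ?]; have := (edge_le_m1 xy, edge_le_m1 yz, edge_le_m1 zx).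
  move=> [[? ?] ?].
  rewrite !inE => /or3P[]/eqP->; rewrite !big_cons big_nil /= !A2; lia.
have [k neq_ki e_jk] := deg2 j i; have [l neq_lj e_kl] := deg2 k j.
have [z neq_zj e_iz] := deg2 i j.
have neq_zk : z != k.
  by apply: contraTneq e_iz => ->; rewrite eC; apply: noC3 e_jk.
have neq_li : l != i by apply: contraTneq e_kl => ->; apply: noC3 e_jk.
have e_zi : dynkin_edge z i by rewrite eC.
have e_ji : dynkin_edge j i by rewrite eC.
have e_kj : dynkin_edge k j by rewrite eC.
have e_lk : dynkin_edge l k by rewrite eC.
have le0 x y : x != y -> cartan_mx D x y <= 0 by apply: A_le0.
have le0' x y : x != y -> cartan_mx D y x <= 0 by rewrite eq_sym => /le0.
have neq_zl : z != l.
  apply/eqP => zl; rewrite -zl in e_kl e_lk.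
  have := @seq_subsolution_large _ _ [:: (z, 1); (i, 1); (j, 1); (k, 1)]
    A_pos isT isT.
  rewrite leqNgt (leq_trans _ n_gt5) // => /(_ _)/negP[]// w.
  rewrite !inE => /or4P[]/eqP->; rewrite !big_cons big_nil /= !A2.
  - have := edge_le_m1 e_zi; have := edge_le_m1 e_lk.
    by have := le0 _ _ neq_zj; clear -D; lia.
  - have := edge_le_m1 e_iz; have := edge_le_m1 e_ij.
    by have := le0' _ _ neq_ki; clear -D; lia.
  - have := edge_le_m1 e_ji; have := edge_le_m1 e_jk.
    by have := le0' _ _ neq_zj; clear -D; lia.
  - have := edge_le_m1 e_kl; have := edge_le_m1 e_kj.
    by have := le0 _ _ neq_ki; clear -D; lia.
have := @seq_subsolution_large _ _ [:: (z, 2); (i, 4); (j, 3); (k, 2); (l, 1)]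
  A_pos isT isT.
rewrite leqNgt n_gt5 => /(_ _)/negP[]// w.
rewrite !inE => /or4P[|||/orP[]] /eqP->; rewrite !big_cons big_nil /= !A2.
- have := edge_le_m1 e_zi; have := le0 _ _ neq_zj; have := le0 _ _ neq_zk.
  by have := le0 _ _ neq_zl; clear -D; lia.
- have := edge_le_m1 e_iz; rewrite Aij; have := le0' _ _ neq_ki.
  by have := le0' _ _ neq_li; clear -D; lia.
- have := edge_le_m1 e_ji; have := edge_le_m1 e_jk; have := le0' _ _ neq_zj.
  by have := le0' _ _ neq_lj; clear -D; lia.
- have := edge_le_m1 e_kj; have := edge_le_m1 e_kl; have := le0' _ _ neq_zk.
  by have := le0 _ _ neq_ki; clear -D; lia.
have := edge_le_m1 e_lk; have := le0' _ _ neq_zl; have := le0 _ _ neq_li.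
by have := le0 _ _ neq_lj; clear -D; lia.
Qed.

(** The height is the 2-adic valuation of the symmetrizing coefficients, once
    their denominators are cleared by the common factor prod_k denq(d_k). *)
Lemma symmetrizable_height (D : dynkin_diagram) :
  (forall i j, dynkin_edge i j ->
     edge_spec (cartan_mx D i j) (cartan_mx D j i)) ->
  symmetrizable_diagram D -> exists h, height_on (cartan_mx D) setT h.
Proof.
move=> edgeP [d [dN0 /matrixP B_sym]].
pose K i : int := numq (d 0 i) * \prod_(k | k != i) denq (d 0 k).
have KE i : (K i)%:~R = d 0 i * (\prod_k denq (d 0 k))%:~R :> rat.
  rewrite (bigD1 i) //= intrM rmorphM /= mulrA; congr (_ * _).
  by rewrite numqE.
have KN0 i : K i != 0.
  rewrite mulf_neq0 ?numq_eq0 //; apply/prodf_neq0 => k _; exact: denq_neq0.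
clearbody K.
have KA i j : K i * cartan_mx D i j = K j * cartan_mx D j i.
  apply: (@intr_inj rat); rewrite !intrM !KE ![d 0 _ * _]mulrC -!mulrA.
  by congr (_ * _); have := B_sym j i; rewrite mxE !mul_diag_mx !mxE.
exists (fun i => logn 2 (absz (K i))) => i j _ _ ij Aij.
have e_ij : dynkin_edge i j by rewrite /dynkin_edge ij.
have Kpos k : (0 < absz (K k))%N by rewrite absz_gt0.
have := KA i j; have [] := edgeP i j e_ij => -[-> ->].
- by rewrite !mulrN1 => /oppr_inj->; constructor 1.
- move=> KK; have -> : K j = 2 * K i by move: KK; lia.
  by constructor 2; rewrite abszM lognM.
move=> KK; have -> : K i = 2 * K j by move: KK; lia.
by constructor 3; rewrite abszM lognM.
Qed.

Lemma symmetric_symmetrizable (D : dynkin_diagram) :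
  symmetric_diagram D -> symmetrizable_diagram D.
Proof.
move=> D_sym; exists (const_mx 1); split=> [i|]; first by rewrite mxE.
rewrite /= diag_const_mx mul1mx; apply/matrixP => i j.
by rewrite -[in RHS]D_sym !mxE.
Qed.

Theorem proposition3p7 (D : dynkin_diagram) (hD : hyperbolic D) :
  (compact_hyperbolic D -> (diagram_rank D <= 5)%N) /\
  ((symmetric_diagram D \/ symmetrizable_diagram D) ->
   compact_hyperbolic D -> (diagram_rank D <= 4)%N).
Proof.
have conn : connected_diagram D by case: hD.
have rank_le4 h : compact_hyperbolic D -> height_on (cartan_mx D) setT h ->
    (diagram_rank D <= 4)%N.
  move=> /compact_minors[A_pos detA].
  exact: rank_le4_of_height (cartan_mxP D) A_pos detA.
split=> [D_comp|D_sym D_comp]; last first.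
  rewrite leqNgt; apply/negP => n_gt4; have [A_pos _] := compact_minors D_comp.
  have [h hh] : exists h, height_on (cartan_mx D) setT h.
    apply: symmetrizable_height.
      by move=> i j; apply: dynkin_edgeP => //; apply: ltnW.
    by case: D_sym => // /symmetric_symmetrizable.
  by have := rank_le4 h D_comp hh; rewrite leqNgt n_gt4.
rewrite leqNgt; apply/negP => n_gt5; have [A_pos _] := compact_minors D_comp.
have edgeP i j :
    dynkin_edge i j -> edge_spec (cartan_mx D i j) (cartan_mx D j i).
  by apply: dynkin_edgeP => //; apply: leq_trans n_gt5.
suff [h hh] : exists h, height_on (cartan_mx D) setT h.
  by have := rank_le4 h D_comp hh; rewrite leqNgt (ltnW n_gt5).
(* The dichotomy is between diagrams that are forests and diagrams in which
   every vertex has degree at least 2. *)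
have [/existsP[v deg_v]|/existsPn no_leaf] :=
    boolP [exists v : 'I_(diagram_rank D), #|[set j | dynkin_edge v j]| <= 1]%N.
  apply: forest_height => // S S_N0.
  have [/proper_has_leaf|] := boolP (S \proper setT); first exact.
  rewrite properT negbK => /eqP->; exists v; rewrite ?inE //.
  by under eq_finset do rewrite inE /=.
have deg2 x y : exists2 z, z != y & @dynkin_edge D x z.
  have := no_leaf x; rewrite -ltnNge => /card_gt1P[z1 [z2 []]].
  rewrite !inE => xz1 xz2 z12; have [z1y|z1y] := eqVneq z1 y; last by exists z1.
  by exists z2; rewrite // -z1y eq_sym.
exists (fun=> 0%N) => i j _ _ ij Aij.
have e_ij : dynkin_edge i j by rewrite /dynkin_edge ij.
have e_ji : dynkin_edge j i by rewrite dynkin_edge_sym.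
have /eqP := no_double_edge_of_min_degree A_pos n_gt5 deg2 e_ij.
have /eqP := no_double_edge_of_min_degree A_pos n_gt5 deg2 e_ji.
by case: (edgeP i j e_ij) => -[-> ->] // _ _; constructor 1.
Qed.
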